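(* Let $A$ be a positive information algebra, let $L$ be a join-semilattice disjoint from $A$, and let $S=A\uplus_{\mathrm{ord}}L$ be the overflow semiring. Write $\mathrm{Id}(R)$ for the set of ideals of a semiring $R$. Then: (i) if $I$ is an ideal of $A$, then $I\cup L$ is an ideal of $S$, and the map $I\mapsto I\cup L$ from $\mathrm{Id}(A)$ to $\mathrm{Id}(S)$ is injective; (ii) if $J$ is an ideal of $S$, then $J\cap A$ is an ideal of $A$; (iii) the contraction map $J\mapsto J\cap A$ is injective on the set of ideals of $S$ containing $L$.
   Context: All semirings are commutative: $(S,+,0)$ and $(S,\cdot,1)$ are commutative monoids, $1\neq 0$, multiplication distributes over addition, and $0$ is absorbing. A semiring is zerosumfree if $a+b=0$ implies $a=b=0$, and entire if $ab=0$ implies $a=0$ or $b=0$; an information algebra is a zerosumfree entire semiring. A positive information algebra is an information algebra with a partial order $\leq$ compatible with $+$ and $\cdot$ (i.e. $x\leq y$ implies $x+z\leq y+z$ and $xz\leq yz$) and having $0$ as least element. An ideal of a semiring $S$ is a nonempty subset $I$ with $a+b\in I$ and $sa\in I$ for all $a,b\in I$, $s\in S$. Overflow semiring $S=A\uplus_{\mathrm{ord}}L$: for a positive information algebra $A$ and a join-semilattice $L$ disjoint from $A$, $S=A\cup L$ with the order extending those of $A$ and $L$ by $a\leq\ell$ for all $a\in A,\ell\in L$ (and never $\ell\leq a$), and operations: $x+y=x+_Ay$ if $x,y\in A$, $x+y=\sup\{x,y\}$ otherwise; $xy=x\cdot_Ay$ if $x,y\in A\setminus\{0\}$, $xy=0$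 if $x=0$ or $y=0$, and $xy=\sup\{x,y\}$ otherwise. With these, $S$ is a positive information algebra. *)

(* Defs.v *)
From HB Require Import structures.
From mathcomp Require Import all_boot all_order all_algebra.
From mathcomp Require Import boolp classical_sets functions.

Set Implicit Arguments.
Unset Strict Implicit.
Unset Printing Implicit Defensive.

Import Order.TTheory GRing.Theory.

Local Open Scope classical_set_scope.
Local Open Scope ring_scope.

(* [comNzSemiRingType] is exactly a commutative semiring with 1 != 0. *)
HB.mixin Record ComNzSemiRing_isInfoAlg A of GRing.ComNzSemiRing A := {
  zerosumfree : forall a b : A, a + b = 0 -> a = 0 /\ b = 0;
  entire : forall a b : A, a * b = 0 -> a = 0 \/ b = 0
}.

#[short(type="infoAlgType")]
HB.structure Definition InfoAlg :=
  {A of GRing.ComNzSemiRing A & ComNzSemiRing_isInfoAlg A}.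

(* The order is a field of the mixin instead of an [Order.POrder] structure on
   [A]: MathComp already joins additive magmas with preorders, at
   [Num.POrderedZmodule], and HB rejects a second join that is not above it. *)
HB.mixin Record InfoAlg_isPositive A of InfoAlg A := {
  ple : rel A;
  ple_refl : reflexive ple;
  ple_anti : antisymmetric ple;
  ple_trans : transitive ple;
  ple_add2r : forall x y z : A, ple x y -> ple (x + z) (y + z);
  ple_mul2r : forall x y z : A, ple x y -> ple (x * z) (y * z);
  ple0 : forall x : A, ple 0 x
}.

#[short(type="posInfoAlgType")]
HB.structure Definition PosInfoAlg :=
  {A of InfoAlg A & InfoAlg_isPositive A}.

Definition semiring_ideal (R : comNzSemiRingType) (I : set R) : Prop :=
  [/\ I !=set0,
      forall a b, I a -> I b -> I (a + b)
    & forall s a, I a -> I (s * a)].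

Definition Id (R : comNzSemiRingType) : set (set R) :=
  [set I | semiring_ideal I].
Arguments Id R : clear implicits.

(* The union of the two carriers, made disjoint by tagging.  It is wrapped in
   a definition so that the instances below do not attach to every [A + L]. *)
Definition overflow (d : Order.disp_t)
  (A : posInfoAlgType) (L : joinSemilatticeType d) : Type := (A + L)%type.

Section Overflow.
Context (d : Order.disp_t) (A : posInfoAlgType) (L : joinSemilatticeType d).

Local Notation S := (overflow A L).

Definition inA (a : A) : S := inl a.
Definition inL (l : L) : S := inr l.

HB.instance Definition _ := Choice.copy S (A + L)%type.

Definition overflow_le (x y : S) : bool :=
  match x, y with
  | inl a, inl b => ple a b
  | inl _, inr _ => true
  | inr _, inl _ => false
  | inr l, inr m => (l <= m)%O
  end.

Fact overflow_le_refl : reflexive overflow_le.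
Proof. by case=> x /=; [apply: ple_refl | apply: lexx]. Qed.

Fact overflow_le_anti : antisymmetric overflow_le.
Proof.
by move=> [x|x] [y|y] //= => [/ple_anti -> | /le_anti ->].
Qed.

Fact overflow_le_trans : transitive overflow_le.
Proof.
by move=> [y|y] [x|x] [z|z] //=; [apply: ple_trans | apply: le_trans].
Qed.

(* Supremum in [S]; used below only when [x] or [y] lies in [L] (two elements
   of [A] need not have a supremum, hence the irrelevant first branch).
   See [overflow_supP]. *)
Definition overflow_sup (x y : S) : S :=
  match x, y with
  | inl _, inl _ => x
  | inl _, inr m => inL m
  | inr l, inl _ => inL l
  | inr l, inr m => inL (l `|` m)%O
  end.

Lemma overflow_supP (x y z : S) : range inL x \/ range inL y ->
  overflow_le (overflow_sup x y) z = overflow_le x z && overflow_le y z.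
Proof.
by case: x y z => [a|l] [b|m] [c|n] [] [] //= ? _ [];
  rewrite ?andbT //= ?leUx ?andbF ?andbT.
Qed.

Definition overflow_add (x y : S) : S :=
  match x, y with
  | inl a, inl b => inA (a + b)
  | _, _ => overflow_sup x y
  end.

Definition overflow_mul (x y : S) : S :=
  if (x == inA 0) || (y == inA 0) then inA 0 else
  match x, y with
  | inl a, inl b => inA (a * b)
  | _, _ => overflow_sup x y
  end.

Let addA_eq0 (a b : A) : (a + b == 0) = (a == 0) && (b == 0).
Proof.
apply/eqP/andP => [/zerosumfree[-> ->] // | [/eqP-> /eqP->]].
by rewrite addr0.
Qed.

Let mulA_eq0 (a b : A) : (a * b == 0) = (a == 0) || (b == 0).
Proof.
apply/eqP/orP => [/entire[]-> | []/eqP->]; rewrite ?eqxx ?mul0r ?mulr0 //.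
  by left.
by right.
Qed.

Fact overflow_addA : associative overflow_add.
Proof. by move=> [x|x] [y|y] [z|z] //=; rewrite ?addrA // joinA. Qed.

Fact overflow_addC : commutative overflow_add.
Proof.
by move=> [x|x] [y|y] //=; congr (_ _); [apply: addrC | apply: joinC].
Qed.

Fact overflow_add0 : left_id (inA 0) overflow_add.
Proof. by case=> x //=; rewrite add0r. Qed.

HB.instance Definition _ :=
  GRing.isNmodule.Build S overflow_addA overflow_addC overflow_add0.

Lemma overflow_mulAA (a b : A) : overflow_mul (inA a) (inA b) = inA (a * b).
Proof.
rewrite /overflow_mul; case: ifP => // /orP[] /eqP[->];
  by rewrite ?mul0r ?mulr0.
Qed.

Let mulAL (a : A) (l : L) :
  overflow_mul (inA a) (inL l) = if a == 0 then inA 0 else inL l.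
Proof. by rewrite /overflow_mul orbF. Qed.

Let mulLA (a : A) (l : L) :
  overflow_mul (inL l) (inA a) = if a == 0 then inA 0 else inL l.
Proof. by []. Qed.

Let mulLL (l m : L) : overflow_mul (inL l) (inL m) = inL (l `|` m)%O.
Proof. by []. Qed.

Let mulE := (overflow_mulAA, mulAL, mulLA, mulLL).

Let addE :=
  ((fun a b => erefl : overflow_add (inA a) (inA b) = inA (a + b)),
   (fun a l => erefl : overflow_add (inA a) (inL l) = inL l),
   (fun a l => erefl : overflow_add (inL l) (inA a) = inL l),
   (fun l m => erefl : overflow_add (inL l) (inL m) = inL (l `|` m)%O)).

Variant overflow_spec : S -> Type :=
  | OverflowA (a : A) : overflow_spec (inA a)
  | OverflowL (l : L) : overflow_spec (inL l).

Let overflowP (x : S) : overflow_spec x.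
Proof. by case: x => [a|l]; [apply: OverflowA | apply: OverflowL]. Qed.

Fact overflow_mulC : commutative overflow_mul.
Proof.
move=> x y; case: (overflowP x) (overflowP y) => x' [] y'; rewrite !mulE //.
  by congr inA; apply: mulrC.
by rewrite joinC.
Qed.

Fact overflow_mul0 : left_zero (inA 0) overflow_mul.
Proof. by move=> x; rewrite /overflow_mul eqxx. Qed.

Fact overflow_mulA : associative overflow_mul.
Proof.
move=> x y z.
case: (overflowP x) (overflowP y) (overflowP z) => x' [] y' [] z';
  rewrite ?mulE ?mulrA ?mulA_eq0 //.
- by case: (boolP (y' == 0)) => y0; case: (boolP (x' == 0)) => x0;
    rewrite ?mulE ?mulr0 ?(negbTE x0) ?x0.
- by case: (boolP (z' == 0)) => z0; case: (boolP (x' == 0)) => x0;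
    rewrite ?mulE ?mulr0 ?mul0r ?(negbTE x0) ?(negbTE z0) ?x0 ?z0.
- by case: ifP => x0; rewrite ?mulE ?x0 ?eqxx.
- by case: (boolP (y' == 0)) => y0; case: (boolP (z' == 0)) => z0;
    rewrite ?mulE ?mul0r ?(negbTE z0) ?z0.
- by case: ifP => y0; rewrite ?mulE ?eqxx.
- by case: ifP => z0; rewrite ?mulE ?eqxx.
- by rewrite joinA.
Qed.

Fact overflow_mul1 : left_id (inA 1) overflow_mul.
Proof.
move=> x; case: (overflowP x) => x'; rewrite mulE ?mul1r //.
by rewrite oner_eq0.
Qed.

Fact overflow_mulDl : left_distributive overflow_mul overflow_add.
Proof.
move=> x y z.
case: (overflowP x) (overflowP y) (overflowP z) => x' [] y' [] z';
  rewrite ?addE ?mulE.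
- by rewrite mulrDl.
- by rewrite addA_eq0; case: eqP => [_|_]; case: eqP => [_|_] /=;
    rewrite ?addE ?addr0 ?joinxx.
- by case: eqP => [->|_]; rewrite ?addE ?mulr0 ?addr0.
- by case: eqP => [_|_]; rewrite ?addE ?add0r // joinCA joinxx.
- by case: eqP => [->|_]; rewrite ?addE ?mulr0 ?addr0.
- by case: eqP => [_|_]; rewrite ?addE ?addr0 // -joinA joinxx.
- by case: eqP => [_|_]; rewrite ?addE ?addr0.
- by rewrite joinACA joinxx.
Qed.

Fact overflow_oner_neq0 : inA 1 != 0 :> S.
Proof. exact: (oner_neq0 A). Qed.

HB.instance Definition _ := GRing.Nmodule_isComNzSemiRing.Build S
  overflow_mulA overflow_mulC overflow_mul1 overflow_mulDl overflow_mul0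
  overflow_oner_neq0.

Fact overflow_zerosumfree (x y : S) : x + y = 0 -> x = 0 /\ y = 0.
Proof. by case: x y => [x|x] [y|y] // [] /zerosumfree[-> ->]. Qed.

Fact overflow_entire (x y : S) : x * y = 0 -> x = 0 \/ y = 0.
Proof.
case: (overflowP x) (overflowP y) => x' [] y';
  rewrite /GRing.mul /= ?mulE //.
- by case=> /entire[]->; [left | right].
- by case: eqP => // -> _; left.
- by case: eqP => // -> _; right.
Qed.

HB.instance Definition _ := ComNzSemiRing_isInfoAlg.Build S
  overflow_zerosumfree overflow_entire.

Fact overflow_le_add2r (x y z : S) :
  overflow_le x y -> overflow_le (x + z) (y + z).
Proof.
case: x y z => [x|x] [y|y] [z|z] //=; rewrite ?lexx ?leUr //.
  exact: ple_add2r.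
by move=> xy; apply: leU2.
Qed.

Fact overflow_le_mul2r (x y z : S) :
  overflow_le x y -> overflow_le (x * z) (y * z).
Proof.
case: (overflowP x) (overflowP y) (overflowP z) => x' [] y' [] z';
  rewrite /GRing.mul /= ?mulE //=.
- exact: ple_mul2r.
- have [->|nx] := eqVneq x' 0; first by case: ifP => //= _ _; apply: ple0.
  case: eqP => [y0 xy|_ _]; last exact: (lexx z').
  by case/eqP: nx; apply: ple_anti; rewrite ple0 andbT -y0.
- by have [->|_] := eqVneq z' 0; rewrite /= ?mulr0 ?ple_refl.
- by case: ifP => //= _ _; apply: leUr.
- by case: ifP => //= _ _; apply: ple_refl.
- by move=> xy; apply: leU2.
Qed.

Fact overflow_le0 (x : S) : overflow_le 0 x.
Proof. by case: x => x //; apply: ple0. Qed.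

HB.instance Definition _ := InfoAlg_isPositive.Build S
  overflow_le_refl overflow_le_anti overflow_le_trans
  overflow_le_add2r overflow_le_mul2r overflow_le0.

End Overflow.

(* Main.v *)
Require Import Defs.
From mathcomp Require Import all_boot all_order all_algebra.
From mathcomp Require Import boolp classical_sets functions.

Local Open Scope classical_set_scope.

(** Extension and contraction undo each other: contracting [I ∪ L] gives back [I], since [A] and [L]
    are disjoint, and extending the contraction of [J] gives back [J] as soon as [J] contains [L].
    Both injectivity claims follow from these set identities. As for ideals, a sum involving an
    element of [L] stays in [L], and such a product is in [L] or is 0, so closure of [I ∪ L] reduces
    to closure of [I] and [0 ∈ I]; contraction works because [A] is a subsemiring of [S]. *)

Lemma ideal0 (R : comNzSemiRingType) (I : set R) : Id R I -> I 0%R.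
Proof.
by case=> -[x Ix] _ /(_ 0%R _ Ix); rewrite GRing.mul0r.
Qed.

Section OverflowIdeals.
Context (d : Order.disp_t) (A : posInfoAlgType) (L : joinSemilatticeType d).

Local Notation S := (overflow A L).
Local Notation inA := (@inA d A L).
Local Notation inL := (@inL d A L).

Lemma overflow_extensionE (I : set A) (x : S) :
  (inA @` I `|` range inL) x = if x is inl a then I a else True.
Proof.
case: x => [a|l]; apply/propext; split=> //.
- by case=> [[b Ib [<-]]|[]].
- by move=> Ia; left; exists a.
- by move=> _; right; exists l.
Qed.

Lemma overflow_extension_preimage (I : set A) :
  inA @^-1` (inA @` I `|` range inL) = I.
Proof. by apply/funext => a; exact: (overflow_extensionE I (inA a)). Qed.

Lemma overflow_preimage_extension (J : set S) :
  range inL `<=` J -> inA @` (inA @^-1` J) `|` range inL = J.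
Proof.
move=> LJ; apply/funext => -[a|l]; rewrite overflow_extensionE //.
by apply/propext; split=> // _; apply: LJ; exists l.
Qed.

Lemma ideal_overflow_extension (I : set A) :
  Id A I -> Id S (inA @` I `|` range inL).
Proof.
move=> idI; have I0 := ideal0 _ _ idI; have [_ ID IM] := idI; split.
- by exists (inA 0%R); rewrite overflow_extensionE.
- move=> [a|l] [b|m]; rewrite !overflow_extensionE //=; exact: ID.
(* If a factor is 0, the product is [inA 0], covered by [I0]; otherwise a factor in [L] forces the
   product into [L]. *)
- move=> s x; rewrite !overflow_extensionE /GRing.mul /= /overflow_mul.
  case: ifP => // _; case: s x => [a|l] [b|m] //=; exact: IM.
Qed.

Lemma ideal_overflow_contraction (J : set S) : Id S J -> Id A (inA @^-1` J).
Proof.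
move=> idJ; have J0 := ideal0 _ _ idJ; have [_ JD JM] := idJ; split.
(* The element witnessing that [J] is nonempty may lie in [L], so 0 is used instead. *)
- by exists 0%R.
- by move=> a b; exact: JD.
(* Sums in [A] and [S] agree by computation; products need [overflow_mulAA] because of the zero test
   in [overflow_mul]. *)
- by move=> a b Jb; rewrite /preimage /= -overflow_mulAA; exact: JM.
Qed.

End OverflowIdeals.

Theorem proposition4p2 (d : Order.disp_t)
    (A : posInfoAlgType) (L : joinSemilatticeType d) :
  let S : posInfoAlgType := overflow A L in
  let inA : A -> S := @inA d A L in
  let inL : L -> S := @inL d A L in
  [/\ (forall I : set A, Id A I -> Id S (inA @` I `|` range inL))
      /\ set_inj (Id A) (fun I : set A => inA @` I `|` range inL),
      forall J : set S, Id S J -> Id A (inA @^-1` J)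
    & set_inj [set J : set S | Id S J /\ range inL `<=` J]
        (fun J : set S => inA @^-1` J)].
Proof.
move=> S inA inL; split.
- split; first exact: ideal_overflow_extension.
  move=> I1 I2 _ _ eqI.
  by rewrite -(overflow_extension_preimage d A L I1) eqI
    overflow_extension_preimage.
- exact: ideal_overflow_contraction.
- move=> J1 J2 /set_mem[_ LJ1] /set_mem[_ LJ2] eqJ.
  by rewrite -(overflow_preimage_extension d A L J1 LJ1) eqJ
    overflow_preimage_extension.
Qed.
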